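(* Let $t_0>0$, assume that $T>t_0$ and that the system $x'+Ax=Bu$, $x(0)=x_0$ is exactly controllable using $L^2$-controls in time $t_0$. Let $x_d\in X$ be a holdable desired state with corresponding constant control $u_d\in U$. For $\gamma>0$ consider the problem $$\mathbf{R}(T,\gamma):\quad \min_{u\in L^2(0,T;U)}\ \tfrac12\,\|u-u_d\|^2_{L^2(0,T;U)}+\gamma\int_{t_0}^T\frac{1}{s-t_0}\,\|x(s)-x_d\|_X\,ds\quad\text{subject to}\quad x'+Ax=Bu,\ x(0)=x_0 .$$ If $\gamma>0$, then the solution $(u_T,x_T)$ (optimal control and corresponding state) of $\mathbf{R}(T,\gamma)$ satisfies $$x_T(t)=x_d\qquad\text{for all } t\in[t_0,T].$$
   Context: $X$ and $U$ are Hilbert spaces with norms $\|\cdot\|_X$, $\|\cdot\|_U$. The operator $-A:\mathcal{D}(A)\subset X\to X$ generates a strongly continuous semigroup on $X$, and $B$ is an admissible control operator for it (in the standard sense: $B$ is bounded from $U$ into the extrapolation space $X_{-1}$ and the input-to-state maps take $L^2(0,t;U)$ boundedly into $X$), so that for every $T>0$, $x_0\in X$ and $u\in L^2(0,T;U)$ the Cauchy problem $x'+Ax=Bu$, $x(0)=x_0$ has a unique (mild) solution $x\in C([0,T];X)$. The initial state $x_0\in X$ is given. Exact controllability using $L^2$-controls in time $t_0$: there is a constant $C_1>0$ such that for all initial states $x_0\in X$ and all terminal states $x_1\in X$ there is $u\in L^2(0,t_0;U)$ such that the solution $x\in C([0,t_0];X)$ of $x'+Ax=Bu$, $x(0)=x_0$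 satisfies $x(t_0)=x_1$ and $\|u\|_{L^2(0,t_0;U)}\le C_1(\|x_0\|_X+\|x_1\|_X)$. Holdable state: $x_d\in X$ is holdable with constant control $u_d\in U$ if a control steering $x_0$ to $x_d$ at time $t_0$ can be extended to $[0,T]$ by the constant control $u_d$ on $(t_0,T)$ with the corresponding state equal to $x_d$ for all $t\in(t_0,T)$; that is, $Ax_d=Bu_d$ (in $X_{-1}$). In $\|u-u_d\|_{L^2(0,T;U)}$, $u_d$ is regarded as a constant function of time. The objective functional may take the value $+\infty$. *)

(* Defs.v *)
From HB Require Import structures.
From mathcomp Require Import all_boot all_order all_algebra sesquilinear.
From mathcomp Require Import all_classical all_reals all_analysis.

Set Implicit Arguments.
Unset Strict Implicit.
Unset Printing Implicit Defensive.

Import Order.TTheory GRing.Theory Num.Theory.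
Import numFieldNormedType.Exports.

Local Open Scope classical_set_scope.
Local Open Scope ring_scope.

Definition hilbert_space (R : realType) (X : completeNormedModType R) : Prop :=
  exists ip : {dot X for idfun}, forall x, `|x| ^+ 2 = ip x x.

Definition simple_function (R : realType) (V : normedModType R)
    (f : R -> V) : Prop :=
  finite_set (range f) /\ forall v, measurable (f @^-1` [set v]).

(* Meant for D of finite measure, so that [fine] loses nothing. *)
Definition simple_integral (R : realType) (V : normedModType R)
    (D : set R) (f : R -> V) : V :=
  \sum_(v \in range f)
    fine (lebesgue_measure (D `&` f @^-1` [set v])) *: v.

(* Convergence is required at every point of D, not only almost everywhere:
   this selects Borel representatives, and every class of strongly measurable
   functions modulo null sets has one. *)
Definition strongly_measurable (R : realType) (V : normedModType R)
    (D : set R) (f : R -> V) : Prop :=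
  exists f_ : nat -> R -> V, (forall n, simple_function (f_ n)) /\
    forall s, D s -> f_ n s @[n --> \oo] --> f s.

Definition is_bochner_integral (R : realType) (V : normedModType R)
    (D : set R) (f : R -> V) (v : V) : Prop :=
  exists f_ : nat -> R -> V,
    [/\ forall n, simple_function (f_ n),
        forall s, D s -> f_ n s @[n --> \oo] --> f s,
        (\int[lebesgue_measure]_(s in D) (`|f s - f_ n s|%:E))%E
          @[n --> \oo] --> 0%E
      & simple_integral D (f_ n) @[n --> \oo] --> v].

(* Elements of L^2(0,T;V) are handled through representatives R -> V, whose
   values outside ]0, T[ are irrelevant. *)
Definition L2 (R : realType) (V : normedModType R) (T : R) (u : R -> V) : Prop :=
  strongly_measurable `]0, T[ u /\
  (\int[lebesgue_measure]_(s in `]0%R, T[) ((`|u s| ^+ 2)%:E) < +oo)%E.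

Definition L2norm (R : realType) (V : normedModType R) (T : R) (u : R -> V) : R :=
  Num.sqrt (\int[lebesgue_measure]_(s in `]0, T[) (`|u s| ^+ 2)).

(* The values S t for t < 0 are irrelevant. *)
Definition c0_semigroup (R : realType) (X : normedModType R)
    (S : R -> {linear X -> X}) : Prop :=
  [/\ forall t, 0 <= t -> continuous (S t),
      forall x, S 0 x = x,
      forall s t x, 0 <= s -> 0 <= t -> S (s + t) x = S s (S t x)
    & forall x, S t x @[t --> 0^'+] --> x].

(* An unbounded operator A is given by its domain DA and a total function, whose
   values outside DA are irrelevant. *)
Definition neg_generates (R : realType) (X : normedModType R)
    (DA : set X) (A : X -> X) (S : R -> {linear X -> X}) : Prop :=
  c0_semigroup S /\
  forall x y, (h^-1 *: (S h x - x) @[h --> 0^'+] --> y) <->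
              (DA x /\ y = - A x).

(* Rb is the resolvent (b I + A)^-1 of -A at b. *)
Definition is_resolvent (R : realType) (X : normedModType R)
    (DA : set X) (A : X -> X) (b : R) (Rb : {linear X -> X}) : Prop :=
  [/\ continuous Rb,
      forall x, DA (Rb x) /\ b *: Rb x + A (Rb x) = x
    & forall x, DA x -> Rb (b *: x + A x) = x].

(* (Xm, j) is the extrapolation space X_{-1}: the completion of X for the norm
   |(b I + A)^-1 x|, with b in the resolvent set of -A. *)
Definition extrapolation_space (R : realType) (X : normedModType R)
    (DA : set X) (A : X -> X)
    (Xm : completeNormedModType R) (j : {linear X -> Xm}) : Prop :=
  dense (range j) /\
  exists (b : R) (Rb : {linear X -> X}),
    is_resolvent DA A b Rb /\ forall x, `|j x| = `|Rb x|.

Definition extrapolated_operator (R : realType) (X : normedModType R)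
    (DA : set X) (A : X -> X)
    (Xm : completeNormedModType R) (j Am : {linear X -> Xm}) : Prop :=
  continuous Am /\ forall x, DA x -> Am x = j (A x).

Definition extrapolated_semigroup (R : realType) (X : normedModType R)
    (S : R -> {linear X -> X})
    (Xm : completeNormedModType R) (j : {linear X -> Xm})
    (Sm : R -> {linear Xm -> Xm}) : Prop :=
  forall t, 0 <= t -> continuous (Sm t) /\ forall x, Sm t (j x) = j (S t x).

Definition input_to_state (R : realType) (U : normedModType R)
    (X : normedModType R) (Xm : completeNormedModType R) (j : {linear X -> Xm})
    (Sm : R -> {linear Xm -> Xm}) (B : {linear U -> Xm})
    (t : R) (u : R -> U) (x : X) : Prop :=
  is_bochner_integral `]0, t[ (fun s => Sm (t - s) (B (u s))) (j x).

Definition admissible_control_operator (R : realType) (U : normedModType R)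
    (X : normedModType R) (Xm : completeNormedModType R) (j : {linear X -> Xm})
    (Sm : R -> {linear Xm -> Xm}) (B : {linear U -> Xm}) : Prop :=
  continuous B /\
  forall t, 0 < t -> exists2 C : R, 0 < C &
    forall u, L2 t u ->
      exists x, input_to_state j Sm B t u x /\ `|x| <= C * L2norm t u.

(* Variation of constants:
   x t = S t x0 + \int_0^t Sm (t - s) (B (u s)) ds, the integral being taken in
   X_{-1}. *)
Definition mild_solution (R : realType) (U : normedModType R)
    (X : normedModType R) (S : R -> {linear X -> X})
    (Xm : completeNormedModType R) (j : {linear X -> Xm})
    (Sm : R -> {linear Xm -> Xm}) (B : {linear U -> Xm})
    (T : R) (x0 : X) (u : R -> U) (x : R -> X) : Prop :=
  {within `[0, T], continuous x} /\
  forall t, 0 <= t <= T -> input_to_state j Sm B t u (x t - S t x0).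

Definition exactly_controllable (R : realType) (U : normedModType R)
    (X : normedModType R) (S : R -> {linear X -> X})
    (Xm : completeNormedModType R) (j : {linear X -> Xm})
    (Sm : R -> {linear Xm -> Xm}) (B : {linear U -> Xm}) (t0 : R) : Prop :=
  exists2 C1 : R, 0 < C1 &
    forall x0 x1 : X, exists (u : R -> U) (x : R -> X),
      [/\ L2 t0 u, mild_solution S j Sm B t0 x0 u x, x t0 = x1
        & L2norm t0 u <= C1 * (`|x0| + `|x1|)].

Definition holdable (R : realType) (U : normedModType R)
    (X : normedModType R) (Xm : completeNormedModType R)
    (Am : {linear X -> Xm}) (B : {linear U -> Xm}) (xd : X) (ud : U) : Prop :=
  Am xd = B ud.

Definition objective (R : realType) (U X : normedModType R)
    (T t0 gamma : R) (xd : X) (ud : U) (u : R -> U) (x : R -> X) : \bar R :=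
  ((2^-1 * L2norm T (fun s => u s - ud) ^+ 2)%:E +
   gamma%:E * \int[lebesgue_measure]_(s in `]t0, T[)
     (((s - t0)^-1 * `|x s - xd|)%:E))%E.

Definition optimal (R : realType) (U : normedModType R)
    (X : normedModType R) (S : R -> {linear X -> X})
    (Xm : completeNormedModType R) (j : {linear X -> Xm})
    (Sm : R -> {linear Xm -> Xm}) (B : {linear U -> Xm})
    (T t0 gamma : R) (x0 xd : X) (ud : U) (u : R -> U) (x : R -> X) : Prop :=
  [/\ L2 T u, mild_solution S j Sm B T x0 u x
    & forall (v : R -> U) (y : R -> X),
        L2 T v -> mild_solution S j Sm B T x0 v y ->
        (objective T t0 gamma xd ud u x <= objective T t0 gamma xd ud v y)%E].

(* Main.v *)
(* A control that steers x0 to xd at time t0 can be continued by ud, the state then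
   staying at xd: in X_{-1} the integral of Sm (t - s) (B ud) over [t0, t[ is
   j (xd - S (t - t0) xd), because B ud = Am xd.  Exact controllability thus gives a
   competitor of finite cost, and finiteness of the optimal cost forces
   xT t0 = xd, since 1 / (s - t0) is not integrable at t0.  Hence the optimal control
   can itself be cut at t0 and continued by ud: this does not increase the control
   cost and kills the tracking term, so by optimality that term is already 0. *)
Require Import Defs.
From HB Require Import structures.
From mathcomp Require Import finmap measurable_realfun ring lra.
From mathcomp Require Import all_boot all_order all_algebra sesquilinear.
From mathcomp Require Import all_classical all_reals all_analysis.
Set Implicit Arguments.
Unset Strict Implicit.
Unset Printing Implicit Defensive.
Import Order.TTheory GRing.Theory Num.Theory.
Import numFieldNormedType.Exports.
Local Open Scope classical_set_scope.
Local Open Scope ring_scope.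

(** [optimal] compares only with controls that come with a mild solution, so the state of the
    competitor has to be exhibited and its integral identity proved in X_{-1} at every time. The
    obstacle is the integral of Sm (t - s) (Am xd): xd need not lie in the domain of A, so its orbit
    need not be differentiable in X, and [is_bochner_integral] asks for explicit simple functions.
    One uniform grid answers both: step functions sampling the orbit converge uniformly, and their
    integrals are Riemann sums whose limit can be computed on the domain. Passing from the domain to
    X requires bounds on S over bounded time intervals, which strong continuity at 0 yields through
    the uniform boundedness principle. A vanishing tracking integral gives xd at every time of
    [t0, T], not just almost everywhere, because the state is continuous. *)

(** * Simple functions and their integrals *)

Section SimpleIntegral.
Variables (R : realType) (V W : normedModType R).
Implicit Types (D : set R) (f g : R -> V).
Local Notation mu := (@lebesgue_measure R).

(** Summing over all of V instead of the range frees the index set from the function, so that two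
    simple integrals can be compared term by term. *)
Lemma simple_integralT D f :
  simple_integral D f = \sum_(v \in setT) fine (mu (D `&` f @^-1` [set v])) *: v.
Proof.
apply: fsbig_widen => // v [_ /= fv].
suff -> : f @^-1` [set v] = set0 by rewrite setI0 measure0 scale0r.
by rewrite -subset0 => s /= fs; apply: fv; exists s.
Qed.

Lemma eq_simple_integral D f g :
  {in D, f =1 g} -> simple_integral D f = simple_integral D g.
Proof.
move=> fg; rewrite !simple_integralT; apply: eq_fsbigr => v _.
congr (fine (mu _) *: _); apply/seteqP; split=> s [Ds /= <-]; split=> //=.
  by rewrite fg ?inE.
by rewrite -fg ?inE.
Qed.

(** [h] need not be injective: cells with the same value form one fibre of [h \o p], whose measure
    is the sum of theirs. With [p] a grid index this yields Riemann sums; with [p] the simple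
    function itself it moves a linear map through the integral. *)
Lemma simple_integral_regroup (I : choiceType) (J : set I) D (p : R -> I)
    (h : I -> V) :
  measurable D -> (mu D < +oo)%E -> finite_set J -> (forall s, D s -> J (p s)) ->
  (forall i, measurable (D `&` p @^-1` [set i])) ->
  simple_integral D (h \o p) = \sum_(i \in J) fine (mu (D `&` p @^-1` [set i])) *: h i.
Proof.
move=> mD Doo finJ Jp mp.
have fin_mu A : measurable A -> A `<=` D -> mu A \is a fin_num.
  move=> mA AD; rewrite ge0_fin_numE ?measure_ge0//.
  by apply: le_lt_trans Doo; apply: le_measure; rewrite ?inE.
rewrite simple_integralT -(fsbig_widen (h @` J)) => //; last first.
  move=> v [_ /= hv].
  suff -> : D `&` (h \o p) @^-1` [set v] = set0 by rewrite measure0 scale0r.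
  by rewrite -subset0 => s [Ds /= hs]; apply: hv; exists (p s) => //; exact: Jp.
rewrite fsbig_finite; last exact: finite_image.
rewrite fset_set_image//.
rewrite [RHS]fsbig_finite//= (partition_big_imfset _ h)/=.
apply: eq_bigr => v _.
transitivity (\sum_(i <- fset_set J | h i == v)
   fine (mu (D `&` p @^-1` [set i])) *: v); last first.
  by apply: eq_bigr => i /eqP ->.
rewrite -scaler_suml; congr (_ *: _).
have -> : D `&` (h \o p) @^-1` [set v] =
    \bigcup_(i in J `&` h @^-1` [set v]) (D `&` p @^-1` [set i]).
  apply/seteqP; split=> [s [Ds /= hs]|s [i [_ /= <-] [Ds <-]]//].
  by exists (p s) => //; split => //; exact: Jp.
rewrite measure_fin_bigcup//; last 3 first.
- exact: finite_setIl.
- by move=> i k _ _ [s [[_ /= <-] [_ /= <-]]].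
- by move=> i _; exact: mp.
rewrite sum_fine; last by move=> i _; exact: fin_mu.
congr fine; rewrite fsbig_mkcondr fsbig_finite//= [RHS]big_mkcond.
apply: eq_bigr => i _; have [<-|hv] := eqVneq (h i) v; first by rewrite mem_set.
by rewrite memNset//; exact/eqP.
Qed.

Lemma simple_function_cst (v : V) : simple_function (fun _ : R => v).
Proof.
split; first by apply: (@sub_finite_set _ _ [set v] _ (finite_set1 _)) => _ [_ _ <-].
move=> w; rewrite preimage_cst; case: ifP => _; first exact: measurableT.
exact: measurable0.
Qed.

Lemma simple_function_comp (f : R -> V) (h : V -> W) :
  simple_function f -> simple_function (h \o f).
Proof.
move=> [ff mf]; split; first by rewrite -(image_comp f h); exact: finite_image.
move=> w.
have -> : (h \o f) @^-1` [set w] =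
    \bigcup_(v in range f `&` h @^-1` [set w]) f @^-1` [set v].
  apply/seteqP; split=> [s /= hs|s [v [_ /= <-] <-]//].
  by exists (f s) => //; split.
apply: fin_bigcup_measurable => //; exact: finite_setIl.
Qed.

Lemma simple_function_patch D f g : measurable D ->
  simple_function f -> simple_function g -> simple_function (patch g D f).
Proof.
move=> mD [ff mf] [fg mg]; split.
  apply: (@sub_finite_set _ _ (range f `|` range g)); last by rewrite finite_setU.
  by move=> _ [s _ <-]; rewrite /patch; case: ifP => _; [left|right]; exists s.
move=> v.
have -> : patch g D f @^-1` [set v] =
    (D `&` f @^-1` [set v]) `|` (~` D `&` g @^-1` [set v]).
  apply/seteqP; split=> s; rewrite /= /patch.
    by case: ifPn; rewrite ?inE ?notin_setE => Ds <-; [left|right].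
  move=> [[Ds]|[Ds]]; first by rewrite mem_set.
  by rewrite memNset.
by apply: measurableU; apply: measurableI => //; exact: measurableC.
Qed.

(** The patch by 0 is there because [simple_function] asks for a finite range and measurable fibres
    on the whole line, while [p] is controlled on D only. *)
Lemma simple_function_step (I : choiceType) (J : set I) D (p : R -> I)
    (h : I -> V) : measurable D -> finite_set J -> (forall s, D s -> J (p s)) ->
  (forall i, measurable (D `&` p @^-1` [set i])) ->
  simple_function (patch (fun=> 0) D (h \o p)).
Proof.
move=> mD finJ Jp mp.
have m v : measurable (D `&` (h \o p) @^-1` [set v]).
  have -> : D `&` (h \o p) @^-1` [set v] =
      \bigcup_(i in J `&` h @^-1` [set v]) (D `&` p @^-1` [set i]).
    apply/seteqP; split=> [s [Ds /= hs]|s [i [_ /= <-] [Ds <-]]//].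
    by exists (p s) => //; split => //; exact: Jp.
  by apply: fin_bigcup_measurable => //; exact: finite_setIl.
split.
  apply: (@sub_finite_set _ _ (h @` J `|` [set 0])); last first.
    by rewrite finite_setU; split => //; exact: finite_image.
  move=> _ [s _ <-]; rewrite /patch; case: ifPn; rewrite ?inE => Ds; [left|by right].
  by exists (p s) => //; exact: Jp.
move=> v.
have -> : (patch (fun=> 0) D (h \o p)) @^-1` [set v] =
    (D `&` (h \o p) @^-1` [set v]) `|` (~` D `&` [set s | 0 = v]).
  apply/seteqP; split=> s; rewrite /= /patch.
    by case: ifPn; rewrite ?inE ?notin_setE => Ds <-; [left|right].
  move=> [[Ds]|[Ds]]; first by rewrite mem_set.
  by rewrite memNset.
apply: measurableU => //.
apply: measurableI; first exact: measurableC.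
have [->|v0] := eqVneq v 0.
  by rewrite (_ : [set _ | _] = setT)//; apply/seteqP; split.
rewrite (_ : [set _ | _] = set0)//; apply/seteqP; split => // s /= v0'.
by move: v0; rewrite -v0' eqxx.
Qed.

(** Every preimage is a finite union of fibres of [f], so [h] may be arbitrary. *)
Lemma measurable_simple (f : R -> V) (h : V -> R) :
  simple_function f -> measurable_fun setT (h \o f).
Proof.
move=> [ff mf] _ Y mY; rewrite setTI.
have -> : (h \o f) @^-1` Y = \bigcup_(v in range f `&` h @^-1` Y) f @^-1` [set v].
  apply/seteqP; split=> [s /= hs|s [v [_ /= hv] /= fs]]; last by rewrite /= fs.
  by exists (f s) => //; split.
by apply: fin_bigcup_measurable => //; exact: finite_setIl.
Qed.

Lemma simple_integral_setU (D1 D2 : set R) f :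
  measurable D1 -> measurable D2 -> (mu D1 < +oo)%E -> (mu D2 < +oo)%E ->
  [disjoint D1 & D2] -> simple_function f ->
  simple_integral (D1 `|` D2) f = simple_integral D1 f + simple_integral D2 f.
Proof.
move=> mD1 mD2 D1oo D2oo D12 [ff mf].
have fin_mu A D : measurable D -> measurable A -> (mu D < +oo)%E ->
    mu (D `&` A) \is a fin_num.
  move=> mD mA Doo; rewrite ge0_fin_numE ?measure_ge0//.
  by apply: le_lt_trans Doo; apply: le_measure; rewrite ?inE//; exact: measurableI.
rewrite /simple_integral !fsbig_finite// -big_split/=; apply: eq_bigr => v _.
have D0 : D1 `&` f @^-1` [set v] `&` (D2 `&` f @^-1` [set v]) = set0.
  by rewrite setIACA (eqP D12) set0I.
have m1 := measurableI _ _ mD1 (mf v); have m2 := measurableI _ _ mD2 (mf v).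
by rewrite -scalerDl setIUl measureU// fineD ?fin_mu.
Qed.

End SimpleIntegral.

Lemma simple_integral_linear (R : realType) (V W : normedModType R)
    (L : {linear V -> W}) (D : set R) (f : R -> V) :
  measurable D -> (lebesgue_measure D < +oo)%E -> simple_function f ->
  simple_integral D (L \o f) = L (simple_integral D f).
Proof.
move=> mD Doo [ff mf]; rewrite (@simple_integral_regroup _ _ _ (range f))//.
- rewrite /simple_integral !fsbig_finite// linear_sum.
  by apply: eq_bigr => v _; rewrite linearZ.
- by move=> i; apply: measurableI.
Qed.

Lemma continuous_linear_bound (R : realType) (V W : normedModType R)
    (L : {linear V -> W}) :
  continuous L -> exists2 K, 0 < K & forall x, `|L x| <= K * `|x|.
Proof.
move=> /linear_bounded_continuous/linear_boundedP/pinfty_ex_gt0[K K0 LK].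
by exists K.
Qed.

Lemma cvge0_le (R : realType) (a : nat -> \bar R) :
  (forall n, 0 <= a n)%E ->
  (forall e : R, 0 < e -> \forall n \near \oo, (a n <= e%:E)%E) ->
  a n @[n --> \oo] --> 0%E.
Proof.
move=> a0 ae; apply/fine_cvgP; split.
  near=> n; rewrite ge0_fin_numE//.
  by apply: (@le_lt_trans _ _ 1%:E); [near: n; exact: ae|rewrite ltry].
apply/cvgrPdist_le => e e0; near=> n => /=.
have ane : (a n <= e%:E)%E by near: n; exact: ae.
rewrite sub0r normrN ger0_norm; last exact: fine_ge0.
by rewrite -lee_fin fineK// ge0_fin_numE// (le_lt_trans ane)// ltry.
Unshelve. all: by end_near. Qed.

(** Reduces binary operations on simple functions to [simple_function_comp]. *)
Lemma simple_function_pair (R : realType) (V W : normedModType R)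
    (f : R -> V) (g : R -> W) :
  simple_function f -> simple_function g ->
  simple_function (fun s => (f s, g s)).
Proof.
move=> [ff mf] [fg mg]; split.
  apply: (@sub_finite_set _ _ (range f `*` range g)); last exact: finite_setX.
  by move=> _ [s _ <-]; split; exists s.
move=> [v w].
have -> : (fun s => (f s, g s)) @^-1` [set (v, w)] =
    f @^-1` [set v] `&` g @^-1` [set w].
  by apply/seteqP; split=> s /= => [[-> ->]|[-> ->]].
by apply: measurableI.
Qed.

(** * Strong measurability *)

Section StronglyMeasurable.
Variables (R : realType) (V : normedModType R).
Implicit Types D : set R.

Lemma strongly_measurable_simple D (f : R -> V) :
  simple_function f -> strongly_measurable D f.
Proof. by move=> sf; exists (fun=> f); split => // s _; exact: cvg_cst. Qed.

Lemma strongly_measurable_sub D (f g : R -> V) :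
  strongly_measurable D f -> strongly_measurable D g ->
  strongly_measurable D (fun s => f s - g s).
Proof.
move=> [f_ [sf cf]] [g_ [sg cg]]; exists (fun n s => f_ n s - g_ n s).
split=> [n|s Ds]; last by apply: cvgB; [exact: cf|exact: cg].
exact: (simple_function_comp (fun p : V * V => p.1 - p.2)
  (simple_function_pair (sf n) (sg n))).
Qed.

Lemma measurable_strongly_measurable D (f : R -> V) (h : V -> R) :
  continuous h -> strongly_measurable D f -> measurable_fun D (h \o f).
Proof.
move=> ch [f_ [sf cf]].
apply/measurable_EFinP.
apply: (emeasurable_fun_cvg (fun n => EFin \o (h \o f_ n))).
  move=> n; apply/measurable_EFinP; apply: measurable_funTS.
  exact: measurable_simple.
move=> s Ds; apply/fine_cvgP; split; first exact: nearW.
by apply: (cvg_comp _ _ (cf s Ds)); exact: ch.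
Qed.

Lemma strongly_measurable_patch D D1 D2 (f g : R -> V) :
  measurable D1 -> D `<=` D1 `|` D2 ->
  strongly_measurable D1 f -> strongly_measurable D2 g ->
  strongly_measurable D (patch g D1 f).
Proof.
move=> mD1 DD [f_ [sf cf]] [g_ [sg cg]].
exists (fun n => patch (g_ n) D1 (f_ n)); split=> [n|s Ds].
  exact: simple_function_patch.
rewrite /patch; case: ifPn; rewrite ?inE ?notin_setE => D1s; first exact: cf.
by case: (DD s Ds) => // D2s; exact: cg.
Qed.

End StronglyMeasurable.

Lemma subset_strongly_measurable (R : realType) (V : normedModType R)
    (D1 D2 : set R) (f : R -> V) :
  D1 `<=` D2 -> strongly_measurable D2 f -> strongly_measurable D1 f.
Proof. by move=> D12 [f_ [sf cf]]; exists f_; split => // s /D12; exact: cf. Qed.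

Lemma measurable_norm_sub_simple (R : realType) (V : normedModType R)
    (D : set R) (f g : R -> V) :
  strongly_measurable D f -> simple_function g ->
  measurable_fun D (fun s => `|f s - g s|%:E).
Proof.
move=> sf sg; apply/measurable_EFinP.
apply: (@measurable_strongly_measurable _ _ _ (fun s => f s - g s) Num.norm).
  exact: norm_continuous.
by apply: strongly_measurable_sub => //; exact: strongly_measurable_simple.
Qed.

(** * Bochner integrals: linear images and disjoint unions *)

Section Bochner.
Variables (R : realType) (V W : normedModType R).
Implicit Types D : set R.
Local Notation mu := (@lebesgue_measure R).

Lemma eq_is_bochner_integral D (f g : R -> V) v :
  {in D, f =1 g} -> is_bochner_integral D f v -> is_bochner_integral D g v.
Proof.
move=> fg [f_ [sf cf If If']]; exists f_; split => //.
  by move=> s Ds; rewrite -fg ?inE//; exact: cf.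
rewrite (_ : (fun n => _) = fun n => (\int[mu]_(s in D) `|f s - f_ n s|%:E)%E)//.
by apply/funext => n; apply: eq_integral => s Ds; rewrite fg.
Qed.

Lemma is_bochner_integral_linear D (f : R -> V) v (L : {linear V -> W}) :
  continuous L -> measurable D -> (mu D < +oo)%E ->
  is_bochner_integral D f v -> is_bochner_integral D (L \o f) (L v).
Proof.
move=> cL mD Doo [f_ [sf cf If If']].
have [K K0 LK] := continuous_linear_bound cL.
have sLf n : simple_function (L \o f_ n) by exact: simple_function_comp.
have cLf s : D s -> (L \o f_ n) s @[n --> \oo] --> (L \o f) s.
  by move=> Ds; apply: (cvg_comp _ _ (cf s Ds)); exact: cL.
exists (fun n => L \o f_ n); split => //; last first.
  under eq_fun do rewrite simple_integral_linear//.
  by apply: (cvg_comp _ _ If'); exact: cL.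
apply: (@squeeze_cvge _ _ _ _ (cst 0%E) _
    (fun n => K%:E * \int[mu]_(s in D) `|f s - f_ n s|%:E)%E).
- apply: nearW => n; rewrite integral_ge0//=.
  rewrite -ge0_integralZl//; last 2 first.
  + by apply: measurable_norm_sub_simple => //; exists f_.
  + by rewrite lee_fin ltW.
  apply: ge0_le_integral => //.
  + apply: (measurable_norm_sub_simple _ (sLf n)).
    by exists (fun n => L \o f_ n).
  + apply: measurable_funeM; apply: measurable_norm_sub_simple => //.
    by exists f_.
  + by move=> s Ds; rewrite -EFinM lee_fin /= -linearB.
- exact: cvg_cst.
- by rewrite -[X in _ --> X](mule0 K%:E); exact: cvgeZl.
Qed.

Lemma is_bochner_integral_setU (D1 D2 : set R) (f : R -> V) v1 v2 :
  measurable D1 -> measurable D2 -> (mu D1 < +oo)%E -> (mu D2 < +oo)%E ->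
  [disjoint D1 & D2] ->
  is_bochner_integral D1 f v1 -> is_bochner_integral D2 f v2 ->
  is_bochner_integral (D1 `|` D2) f (v1 + v2).
Proof.
move=> mD1 mD2 D1oo D2oo D12 [f_ [sf cf If If']] [g_ [sg cg Ig Ig']].
pose h n := patch (g_ n) D1 (f_ n).
have h1 n : {in D1, h n =1 f_ n} by move=> s Ds; rewrite /h patchT.
have h2 n : {in D2, h n =1 g_ n}.
  move=> s; rewrite inE => Ds; rewrite /h patchN//.
  apply/negP; rewrite inE => D1s.
  by move: D12; rewrite disj_set2E => /eqP/seteqP[/(_ s) + _]; exact.
have sh n : simple_function (h n) by exact: simple_function_patch.
have ch s : (D1 `|` D2) s -> h n s @[n --> \oo] --> f s.
  move=> [Ds|Ds].
  - by under eq_fun do rewrite h1 ?inE//; exact: cf.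
  - by under eq_fun do rewrite h2 ?inE//; exact: cg.
exists h; split=> //.
- rewrite (_ : (fun n => _) = fun n => (\int[mu]_(s in D1) `|f s - f_ n s|%:E +
      \int[mu]_(s in D2) `|f s - g_ n s|%:E)%E); last first.
    apply/funext => n; rewrite ge0_integral_setU//.
      by congr (_ + _)%E; apply: eq_integral => s Ds; [rewrite h1|rewrite h2].
    by apply: measurable_norm_sub_simple => //; exists h.
  by rewrite -[X in _ --> X]adde0; apply: cvgeD.
- under eq_fun => n.
    rewrite simple_integral_setU// (eq_simple_integral (@h1 n)).
    rewrite (eq_simple_integral (@h2 n)).
    over.
  exact: cvgD.
Qed.

End Bochner.

(** The set where f and g differ is open; were it nonempty, it would meet D. *)
Lemma dense_eq (R : realType) (V W : normedModType R) (D : set V) (f g : V -> W) :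
  dense D -> continuous f -> continuous g -> {in D, f =1 g} -> f =1 g.
Proof.
move=> dD cf cg fg x; apply/eqP; rewrite -subr_eq0; apply/negPn/negP => fgx.
have oO : open ((fun y => `|f y - g y|) @^-1` [set r | 0 < r]).
  apply: open_comp; last exact: open_gt.
  by move=> y _; apply: cvg_norm; apply: cvgB; [exact: cf|exact: cg].
have [|y [/= fgy Dy]] := dD _ _ oO; first by exists x; rewrite /= normr_gt0.
by move: fgy; rewrite fg ?subrr ?normr0 ?ltxx// inE.
Qed.

Lemma dense_norm (R : realType) (V : normedModType R) (D : set V) :
  dense D <-> forall x e, 0 < e -> exists2 y, D y & `|x - y| < e.
Proof.
split=> [dD x e e0|dD O [x Ox] oO].
  have [||y [xy Dy]] := dD (ball x e); [by exists x; exact: ballxx|exact: ball_open|].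
  by exists y => //; move: xy; rewrite -ball_normE.
have /nbhs_ballP[e /= e0 xeO] : nbhs x O by exact: open_nbhs_nbhs.
have [y Dy xy] := dD x e e0; exists y; split => //.
by apply: xeO; rewrite -ball_normE.
Qed.

(** * Strongly continuous semigroups: bounds, orbits, domain of the generator *)

Section Semigroup.
Variables (R : realType) (X : completeNormedModType R).
Variable S : R -> {linear X -> X}.
Hypothesis c0S : c0_semigroup S.

Lemma c0_semigroup_bounded_near0 : exists d M : R,
  [/\ 0 < d, 1 <= M & forall r x, 0 <= r <= d -> `|S r x| <= M * `|x|].
Proof.
have [cS S0 _ Sx] := c0S.
apply: contrapT => unbounded.
(* The negated claim at d = 1 / (n + 1) and M = n + 1. The time is positive because S 0 is the
   identity and M is at least 1. *)
have /choice[t /all_and2[t0 tS]] : forall n : nat, exists t : R,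
    0 < t <= n.+1%:R^-1 /\ exists x, n.+1%:R * `|x| < `|S t x|.
  move=> n; apply: contrapT => nt; apply: unbounded.
  exists n.+1%:R^-1, n.+1%:R; split; [by rewrite invr_gt0|by rewrite ler1n|].
  move=> r x /andP[]; rewrite le_eqVlt => /predU1P[<- _|r0 rn].
    by rewrite S0 ler_peMl// ler1n.
  rewrite leNgt; apply/negP => Srx; apply: nt; exists r.
  by rewrite r0 rn; split => //; exists x.
have tcvg : t n @[n --> \oo] --> (0 : R)^'+.
  move=> A [e /= e0 eA]; suff: \forall n \near \oo, A (t n) by [].
  near=> n; have /andP[tn0 tn] := t0 n.
  apply: eA => //; rewrite /= sub0r normrN gtr0_norm// (le_lt_trans tn)//.
  by near: n; exact: (near_infty_natSinv_lt (PosNum e0)).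
(* Each orbit converges along [t n], hence is bounded there; uniform boundedness then bounds all
   [S (t n)] on the unit ball. *)
have [||M bM] := @Banach_Steinhauss _ _ _ (range (fun n => S (t n) : X -> X)) _ _ 1.
- move=> _ [n _ <-]; split; last exact: linearP.
  apply/bounded_funP/linear_bounded_continuous/cS.
  by have /andP[/ltW] := t0 n.
- move=> x.
  have Stx : S (t n) x @[n --> \oo] --> x by exact: cvg_comp tcvg (Sx x).
  have /cvg_seq_bounded[K [_ bK]] : cvgn (fun n => S (t n) x) by apply/cvg_ex; exists x.
  exists (K + 1) => _ [n _ <-]; by apply: bK => //; rewrite ltrDl.
(* For this index n + 1 exceeds [M], against the growth recorded in [tS]. *)
pose n := Num.truncn M.
have [x Sx_gt] := tS n.
have x0 : x != 0.
  by apply/eqP => x0; move: Sx_gt; rewrite x0 linear0 normr0 mulr0 ltxx.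
have := bM _ (ex_intro2 _ _ n I erefl) (`|x|^-1 *: x).
rewrite linearZ/= !normrZ normfV normr_id mulVf ?normr_eq0// => /(_ (lexx _)).
rewrite ler_pdivrMl ?normr_gt0// => /(lt_le_trans Sx_gt).
rewrite mulrC ltr_pM2l ?normr_gt0// => /ltW.
by rewrite leNgt truncnS_gt.
Unshelve. all: by end_near. Qed.

Lemma c0_semigroup_bounded (tau : R) : exists2 M : R, 0 < M &
  forall r x, 0 <= r <= tau -> `|S r x| <= M * `|x|.
Proof.
have [d [M [d0 M1 SM]]] := c0_semigroup_bounded_near0.
have M0 : 0 < M by exact: lt_le_trans M1.
have SMk k r x : 0 <= r <= k%:R * d -> `|S r x| <= M ^+ k.+1 * `|x|.
  elim: k r x => [|k IH] r x /andP[r0 rk].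
    by rewrite expr1; apply: SM; rewrite r0 (le_trans rk)// mul0r ltW.
  have [rd|dr] := leP r d.
    apply: le_trans (SM _ _ _) _; first by rewrite r0.
    by rewrite ler_wpM2r// exprS ler_peMr ?(ltW M0)// exprn_ege1.
  have [_ _ SD _] := c0S.
  rewrite -(subrKC d r) SD ?(ltW d0)// ?subr_ge0 ?(ltW dr)//.
  apply: le_trans (SM _ _ _) _; first by rewrite (ltW d0) lexx.
  rewrite exprS -mulrA ler_pM2l//; apply: IH.
  by rewrite subr_ge0 (ltW dr)/= lerBlDr -[X in _ + X]mul1r -mulrDl natr1.
(* Covering tau takes truncn (tau / d) + 1 steps of length [d], and [SMk] has one more factor [M]
   than steps. *)
exists (M ^+ (Num.truncn (tau / d)).+2); first exact: exprn_gt0.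
move=> r x /andP[r0 rt]; apply: SMk; rewrite r0/= (le_trans rt)//.
by rewrite -ler_pdivrMr// ltW// truncnS_gt.
Qed.

(** For a <= b, S a x - S b x = S a (x - S (b - a) x), so right-continuity at 0 and the bound of S
    on [0, tau] suffice. *)
Lemma orbit_unif_continuous (tau : R) x (e : R) : 0 < e -> exists2 d : R, 0 < d &
  forall a b, 0 <= a <= tau -> 0 <= b <= tau -> `|a - b| <= d ->
    `|S a x - S b x| <= e.
Proof.
move=> e0; have [M M0 SM] := c0_semigroup_bounded tau.
have [_ S0 SD Sx] := c0S.
have /cvgrPdist_le/(_ _ (divr_gt0 e0 M0)) := Sx x.
move=> [d /= d0 Sd]; exists (d / 2); first exact: divr_gt0.
suff le_case a b : 0 <= a -> a <= b -> b <= tau -> b - a <= d / 2 ->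
    `|S a x - S b x| <= e.
  move=> a b /andP[a0 at_] /andP[b0 bt] ab; have [leab|leba] := leP a b.
    by apply: le_case => //; rewrite (le_trans _ ab)// distrC ler_norm.
  rewrite distrC; apply: le_case => //; first exact: ltW.
  by rewrite (le_trans _ ab)// ler_norm.
move=> a0 ab bt bad.
rewrite -(subrKC a b) SD ?subr_ge0// -linearB.
apply: le_trans (SM _ _ _) _; first by rewrite a0 (le_trans ab).
rewrite -ler_pdivlMl// mulrC.
(* The limit at 0 from the right says nothing at 0 itself. *)
have [->|ba] := eqVneq b a; first by rewrite subrr S0 subrr normr0 divr_ge0 ?ltW.
apply: Sd; last by rewrite subr_gt0 lt_neqAle eq_sym ba.
rewrite /= sub0r normrN ger0_norm ?subr_ge0// (le_lt_trans bad)//.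
by rewrite ltr_pdivrMr// ltr_pMr// ltr1n.
Qed.

Variables (DA : set X) (A : X -> X).
Hypothesis genA : neg_generates DA A S.

Lemma domain_linear a u v : DA u -> DA v -> DA (a *: u + v).
Proof.
move=> Du Dv; have [_ gen] := genA.
have /gen : h^-1 *: (S h (a *: u + v) - (a *: u + v)) @[h --> 0^'+] -->
    a *: - A u + - A v.
  under eq_fun => h.
    rewrite linearP opprD addrACA -scalerBr scalerDr scalerA mulrC -scalerA; over.
  by apply: cvgD; [apply: cvgZr|]; apply/gen.
by case.
Qed.

(** The difference quotient of [S t x] is the image under [S t] of that of x; its limit yields both
    the membership and the value. *)
Lemma domain_semigroup t x : 0 <= t -> DA x -> DA (S t x) /\ A (S t x) = S t (A x).
Proof.
move=> t0 Dx; have [[cS S0 SD _] gen] := genA.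
have /gen[Dt At] : h^-1 *: (S h (S t x) - S t x) @[h --> 0^'+] --> - S t (A x).
  have /gen Ax : DA x /\ - A x = - A x by [].
  have : S t (h^-1 *: (S h x - x)) @[h --> 0^'+] --> S t (- A x).
    exact: cvg_comp Ax (cS t t0 _).
  rewrite linearN; apply: cvg_trans; apply: near_eq_cvg; near=> h.
  have h0 : 0 <= h by apply: ltW; near: h; exact: nbhs_right_gt.
  by rewrite linearZ/= linearB/= -!SD// [t + h]addrC.
by split => //; apply: oppr_inj.
Unshelve. all: by end_near. Qed.

(* x = b Rb x + A (Rb x), and A (Rb x) is a limit of difference quotients of the
   orbit of Rb x, which stay in the domain. *)
Lemma dense_domain b Rb : is_resolvent DA A b Rb -> dense DA.
Proof.
move=> [_ DRb _]; have [_ gen] := genA; apply/dense_norm => x e e0.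
have [Dx xE] := DRb x.
have /gen/cvgrPdist_lt/(_ _ e0) : DA (Rb x) /\ - A (Rb x) = - A (Rb x) by [].
move=> [d /= d0 Sd].
have d2 : 0 < d / 2 by exact: divr_gt0.
pose q := (d / 2)^-1 *: (S (d / 2) (Rb x) - Rb x).
exists (b *: Rb x - q); last first.
  have eqx (u v a w : X) : v + a = u -> u - (v - w) = - (- a - w).
    by move=> <-; rewrite !opprB opprK [v + a]addrC [w - v]addrC addrA addrK addrC.
  rewrite (eqx _ _ _ _ xE) normrN; apply: Sd => //.
  by rewrite /= sub0r normrN gtr0_norm// ltr_pdivrMr// ltr_pMr// ltr1n.
have D0 : DA 0 by rewrite -(addNr (Rb x)) -scaleN1r; exact: domain_linear.
have [DSx _] := domain_semigroup (ltW d2) Dx.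
apply: domain_linear => //.
rewrite /q -scaleNr -[X in DA X]addr0; apply: domain_linear => //.
by rewrite addrC -scaleN1r; exact: domain_linear.
Qed.

End Semigroup.

(** * The extrapolation space and Riemann sums of orbits in it *)

Section Extrapolation.
Variables (R : realType) (X : completeNormedModType R).
Variables (DA : set X) (A : X -> X) (S : R -> {linear X -> X}).
Hypothesis genA : neg_generates DA A S.
Variables (Xm : completeNormedModType R) (j : {linear X -> Xm}).
Hypothesis exXm : extrapolation_space DA A j.
Variable Am : {linear X -> Xm}.
Hypothesis exA : extrapolated_operator DA A j Am.
Variable Sm : R -> {linear Xm -> Xm}.
Hypothesis exS : extrapolated_semigroup S j Sm.

Lemma extrapolation_embedding_continuous : continuous j.
Proof.
have [_ [b [Rb [[cRb _ _] jE]]]] := exXm.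
have [K K0 RbK] := continuous_linear_bound cRb.
apply/linear_bounded_continuous/linear_boundedP.
exists K; split=> [|r /ltW Kr x]; first exact: num_real.
by rewrite jE (le_trans (RbK x))// ler_wpM2r.
Qed.

Lemma generator_domain_dense : dense DA.
Proof. by have [_ [b [Rb [DRb _]]]] := exXm; exact: (dense_domain genA DRb). Qed.

(** [Sm] is specified on the range of [j], from which density and continuity carry the semigroup law
    to X_{-1}. *)
Lemma extrapolated_semigroupD s t x : 0 <= s -> 0 <= t ->
  Sm (s + t) x = Sm s (Sm t x).
Proof.
move=> s0 t0; have [[_ _ SD _] _] := genA; have [dj _] := exXm.
have [cs js] := exS s0; have [ct jt] := exS t0.
have [cst jst] := exS (addr_ge0 s0 t0).
apply: (@dense_eq _ _ _ (range j) (fun y => Sm (s + t) y)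
  (fun y => Sm s (Sm t y))) => //.
  by move=> y; apply: (cvg_comp _ _ (ct y)); exact: cs.
by move=> _ /set_mem[y _ <-]; rewrite jst jt js SD.
Qed.

(** On the domain, which is dense in X, both sides are [j (S t (A x))]. *)
Lemma extrapolated_semigroup_operator t x : 0 <= t -> Sm t (Am x) = Am (S t x).
Proof.
move=> t0; have [[cS _ _ _] _] := genA; have [cAm AmE] := exA.
have [ct jt] := exS t0.
apply: (@dense_eq _ _ _ DA (fun y => Sm t (Am y)) (fun y => Am (S t y))).
- exact: generator_domain_dense.
- by move=> y; apply: (cvg_comp _ _ (cAm y)); exact: ct.
- by move=> y; apply: (cvg_comp _ _ (cS _ t0 y)); exact: cAm.
- move=> y /set_mem Dy; have [DSy ASy] := domain_semigroup genA t0 Dy.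
  by rewrite !AmE// jt ASy.
Qed.

(* On the domain, x - S t x telescopes into the sum of S (k h) (x - S h x), and
   (x - S h x) / h tends to A x; density and the uniform bounds of S extend the
   convergence to every state. *)
Lemma riemann_sum_semigroup (t : R) x : 0 < t ->
  \sum_(k < n.+1) (t / n.+1%:R) *: Am (S (k%:R * (t / n.+1%:R)) x) @[n --> \oo]
    --> j (x - S t x).
Proof.
move=> t0; have [[_ S0 SD _] gen] := genA; have [cAm AmE] := exA.
have [M M0 SM] := c0_semigroup_bounded (proj1 genA) t.
have [Kj Kj0 jK] := continuous_linear_bound extrapolation_embedding_continuous.
have [KA KA0 AmK] := continuous_linear_bound cAm.
have hn0 n : 0 < t / n.+1%:R by rewrite divr_gt0.
have kn_in n (k : 'I_n.+1) : 0 <= k%:R * (t / n.+1%:R) <= t.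
  rewrite mulr_ge0//= ?(ltW (hn0 n))// mulrCA ger_pMr//.
  by rewrite ler_pdivrMr// mul1r ler_nat ltnW.
(* The defect is additive in y and, by [rest_le], bounded uniformly in n; this is what lets the
   density argument work. *)
pose rest n y := \sum_(k < n.+1) (t / n.+1%:R) *: Am (S (k%:R * (t / n.+1%:R)) y)
  - j (y - S t y).
have restB n y z : rest n (y - z) = rest n y - rest n z.
  have ACB (V : zmodType) (a b c d : V) : a - b - (c - d) = a - c - (b - d).
    by rewrite !opprB addrACA [RHS]addrACA [- b - c]addrC.
  rewrite /rest [S t _]linearB/= ACB linearB/= -ACB -sumrB; congr (_ - _).
  by apply: eq_bigr => k _; rewrite !linearB.
have rest_le n y : `|rest n y| <= (t * KA * M + Kj * (1 + M)) * `|y|.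
  rewrite mulrDl (le_trans (ler_normB _ _))// lerD//.
    apply: le_trans (ler_norm_sum _ _ _) _.
    rewrite (_ : t * KA * M * `|y| =
        \sum_(k < n.+1) (t / n.+1%:R) * (KA * (M * `|y|))); last first.
      rewrite sumr_const card_ord -[RHS]mulr_natl mulrA [_%:R * _]mulrC.
      by rewrite divfK// !mulrA.
    apply: ler_sum => k _; rewrite normrZ gtr0_norm// ler_pM2l//.
    by rewrite (le_trans (AmK _))// ler_pM2l// SM.
  rewrite (le_trans (jK _))// -mulrA ler_pM2l// mulrDl mul1r.
  by rewrite (le_trans (ler_normB _ _))// lerD2l SM// lexx ltW.
have rest_dom y : DA y -> rest n y @[n --> \oo] --> 0.
  (* [d n] tends to 0 because the quotient tends to - A y. By [restE] the defect is a sum of images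
     of [d n] under S and [j], of total weight t. *)
  move=> Dy; pose d n := A y + (t / n.+1%:R)^-1 *: (S (t / n.+1%:R) y - y).
  have restE n : rest n y = \sum_(k < n.+1) (t / n.+1%:R) *:
      j (S (k%:R * (t / n.+1%:R)) (d n)).
    rewrite /rest; have -> : y - S t y = - \sum_(k < n.+1)
        S (k%:R * (t / n.+1%:R)) (S (t / n.+1%:R) y - y).
      transitivity (- \sum_(0 <= k < n.+1) (S (k.+1%:R * (t / n.+1%:R)) y -
          S (k%:R * (t / n.+1%:R)) y)).
        by rewrite telescope_sumr// mul0r S0 mulrC divfK ?opprB.
      rewrite big_mkord; congr (- _); apply: eq_bigr => k _.
      rewrite linearB/= -SD ?(ltW (hn0 _))//; last first.
        by have /andP[] := kn_in n k.
      by rewrite -natr1 mulrDl mul1r.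
    rewrite linearN opprK linear_sum -big_split/=; apply: eq_bigr => k _.
    have /andP[kh0 _] := kn_in n k.
    have [DSy ASy] := domain_semigroup genA kh0 Dy.
    rewrite AmE// ASy /d; move: (S _ y - y) => z.
    rewrite [in RHS]linearD/= linearZ/= linearD/= linearZ/= scalerDr scalerA.
    by rewrite divff ?scale1r// gt_eqF.
  have tcvg : t / n.+1%:R @[n --> \oo] --> (0 : R)^'+.
    move=> O [e /= e0 eO].
    suff: \forall n \near \oo, O (t / n.+1%:R) by [].
    near=> n; apply: eO => //; rewrite /= sub0r normrN gtr0_norm//.
    rewrite mulrC -ltr_pdivlMr//; near: n.
    exact: (near_infty_natSinv_lt (PosNum (divr_gt0 e0 t0))).
  have dcvg : d n @[n --> \oo] --> 0.
    have /gen Ay : DA y /\ - A y = - A y by [].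
    rewrite -(subrr (A y)); apply: cvgD; first exact: cvg_cst.
    exact: cvg_comp tcvg Ay.
  apply: norm_cvg0; apply: (@squeeze_cvgr _ _ _ _ (cst 0) (fun n => t * Kj * M * `|d n|)).
  - apply: nearW => n; rewrite normr_ge0/= restE.
    apply: le_trans (ler_norm_sum _ _ _) _.
    rewrite (_ : t * Kj * M * `|d n| =
        \sum_(k < n.+1) (t / n.+1%:R) * (Kj * (M * `|d n|))); last first.
      rewrite sumr_const card_ord -[RHS]mulr_natl mulrA [_%:R * _]mulrC.
      by rewrite divfK// !mulrA.
    apply: ler_sum => k _; rewrite normrZ gtr0_norm// ler_pM2l//.
    by rewrite (le_trans (jK _))// ler_pM2l// SM.
  - exact: cvg_cst.
  - rewrite -(mulr0 (t * Kj * M)); apply: cvgMr.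
    by rewrite -(normr0 X); exact: cvg_norm.
apply/subr_cvg0.
set C := t * KA * M + Kj * (1 + M) in rest_le.
have C0 : 0 < C by rewrite addr_gt0 ?mulr_gt0// addr_gt0.
apply/cvgrPdist_le => e e0; have e2 : 0 < e / 2 by exact: divr_gt0.
have [y Dy xy] := (dense_norm DA).1 generator_domain_dense x _ (divr_gt0 e2 C0).
have /cvgrPdist_le/(_ _ e2) resty := rest_dom y Dy.
near=> n; rewrite sub0r normrN -/(rest n x).
rewrite -[rest n x](subrK (rest n y)) -restB (le_trans (ler_normD _ _))//.
rewrite [leRHS]splitr lerD//.
  rewrite (le_trans (rest_le _ _))// mulrC -ler_pdivlMr// ltW//.
by rewrite -normrN -sub0r; near: n.
Unshelve. all: by end_near. Qed.

End Extrapolation.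

(** * The integral produced by a holding control *)

Section HoldingIntegral.
Variables (R : realType) (X : completeNormedModType R).
Variables (DA : set X) (A : X -> X) (S : R -> {linear X -> X}).
Hypothesis genA : neg_generates DA A S.
Variables (Xm : completeNormedModType R) (j : {linear X -> Xm}).
Hypothesis exXm : extrapolation_space DA A j.
Variable Am : {linear X -> Xm}.
Hypothesis exA : extrapolated_operator DA A j Am.
Variable Sm : R -> {linear Xm -> Xm}.
Hypothesis exS : extrapolated_semigroup S j Sm.
Local Notation mu := (@lebesgue_measure R).

(** On the k-th of n + 1 cells of length [h n], the time t - s is replaced by its infimum (n - k) h;
    uniform continuity of the orbit makes these step functions converge uniformly. *)
Lemma is_bochner_integral_semigroup (a t : R) x : a < t ->
  is_bochner_integral `[a, t[ (fun s => Sm (t - s) (Am x)) (j (x - S (t - a) x)).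
Proof.
move=> at_; pose tau := t - a; have tau0 : 0 < tau by rewrite subr_gt0.
have [cAm _] := exA; have [KA KA0 AmK] := continuous_linear_bound cAm.
pose h n : R := tau / n.+1%:R.
have h0 n : 0 < h n by rewrite divr_gt0.
have nh n : n.+1%:R * h n = tau by rewrite mulrC divfK.
set D := [set` `[a, t[].
have mD : measurable D by exact: measurable_itv.
have muD : mu D = tau%:E by rewrite lebesgue_measure_itv/= lte_fin at_ -EFinD.
pose p n (s : R) := Num.truncn ((s - a) / h n).
have pE n s k : D s -> (p n s == k) = (a + k%:R * h n <= s < a + k.+1%:R * h n).
  rewrite /D/= in_itv/= => /andP[sa _].
  rewrite truncn_eq; last by rewrite divr_ge0 ?subr_ge0// ltW.
  by rewrite ler_pdivlMr// ltr_pdivrMr// lerBrDl ltrBlDl.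
have p_lt n s : D s -> `I_n.+1 (p n s).
  rewrite /D/= in_itv/= => /andP[sa st].
  have sa0 : 0 <= (s - a) / h n by rewrite divr_ge0 ?subr_ge0// ltW.
  by rewrite truncn_lt_nat// ltr_pdivrMr// nh ltrD2r.
have pD : forall n k, D `&` p n @^-1` [set k] =
    D `&` [set` `[a + k%:R * h n, a + k.+1%:R * h n[].
  move=> n k; apply/seteqP; split=> s [Ds] /=.
    by move=> pk; split; rewrite //= in_itv/= -pE//; exact/eqP.
  by rewrite in_itv/= -pE// => /eqP.
have mpD n k : measurable (D `&` p n @^-1` [set k]).
  by rewrite pD; apply: measurableI.
have mu_cell n k : (k < n.+1)%N -> fine (mu (D `&` p n @^-1` [set k])) = h n.
  move=> kn; rewrite pD setIidr.
    rewrite lebesgue_measure_itv/= lte_fin ltrD2l ltr_pM2r// ltr_nat ltnSn/=.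
    by rewrite -natr1; ring.
  move=> s; rewrite /D/= !in_itv/= => /andP[sk ks]; apply/andP; split.
    by rewrite (le_trans _ sk)// lerDl mulr_ge0// ltW.
  rewrite (lt_le_trans ks)// -(subrKC a t) lerD2l -[t - a]/tau -(nh n).
  by rewrite ler_pM2r// ler_nat.
pose g n k := Am (S ((n - k)%:R * h n) x).
pose f_ n := patch (fun=> 0) D (g n \o p n).
have sf n : simple_function (f_ n).
  by apply: (@simple_function_step _ _ _ `I_n.+1); [|exact: finite_II|exact: p_lt|].
(* Serves twice: for the pointwise limit and, D having finite measure, for the limit in L^1. *)
have unif e : 0 < e -> \forall n \near \oo, forall s, D s ->
    `|Sm (t - s) (Am x) - f_ n s| <= e.
  move=> e0.
  have [d d0 Sd] := orbit_unif_continuous (proj1 genA) tau x (divr_gt0 e0 KA0).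
  near=> n => s Ds.
  have hnd : h n <= d.
    rewrite /h mulrC -ler_pdivlMr// ltW//; near: n.
    exact: (near_infty_natSinv_lt (PosNum (divr_gt0 d0 tau0))).
  have pn := p_lt n s Ds.
  have : p n s == p n s by [].
  rewrite pE// => /andP[ps sp].
  have /andP[sa st] : a <= s < t by move: Ds; rewrite /D/= in_itv.
  have nkE : (n - p n s)%:R * h n = tau - (p n s).+1%:R * h n.
    by rewrite -(nh n) -mulrBl -natrB.
  have n0 : 0 <= (n - p n s)%:R * h n by rewrite mulr_ge0// ltW.
  rewrite /f_ /patch mem_set// /g/=.
  rewrite (extrapolated_semigroup_operator genA exXm exA exS); last by lra.
  rewrite -linearB (le_trans (AmK _))// mulrC -ler_pdivlMr//.
  have stau : 0 <= t - s <= tau by rewrite /tau; lra.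
  have ntau : 0 <= (n - p n s)%:R * h n <= tau.
    by rewrite n0 nkE gerBl mulr_ge0// ltW.
  apply: Sd => //; rewrite (le_trans _ hnd)// nkE ler_norml.
  move: ps sp; rewrite -natr1 mulrDl mul1r /tau; have := h0 n.
  move: (_ * h n) => ph hn0 ps sp; lra.
have cf s : D s -> f_ n s @[n --> \oo] --> Sm (t - s) (Am x).
  move=> Ds; apply/cvgrPdist_le => e e0.
  by near=> n; move: (s) Ds; near: n; exact: unif.
exists f_; split=> //.
- apply: cvge0_le => [n|e e0]; first exact: integral_ge0.
  near=> n; have fe : forall s, D s -> `|Sm (t - s) (Am x) - f_ n s| <= e / tau.
    by near: n; apply: unif; exact: divr_gt0.
  apply: (@le_trans _ _ (\int[mu]_(s in D) cst (e / tau)%:E s)%E).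
    apply: ge0_le_integral => //.
    apply: measurable_norm_sub_simple => //; by exists f_.
  rewrite integral_cst// [X in (_ * X)%E](_ : _ = tau%:E)//.
  by rewrite -EFinM divfK// gt_eqF.
- rewrite (_ : (fun n => _) = fun n =>
      \sum_(k < n.+1) (t - a) / n.+1%:R *: Am (S (k%:R * ((t - a) / n.+1%:R)) x)).
    exact: (riemann_sum_semigroup genA exXm exA).
  apply/funext => n.
  rewrite (@eq_simple_integral _ _ _ _ (g n \o p n)); last first.
    by move=> s Ds; rewrite /f_ patchT.
  rewrite (@simple_integral_regroup _ _ _ `I_n.+1)//; last 2 first.
  + by rewrite [mu _]muD ltry.
  + exact: p_lt.
  (* Sampling runs backwards in time; exchanging k and n - k gives the order of
     [riemann_sum_semigroup]. *)
  rewrite -fsbig_ord (reindex_inj rev_ord_inj)/=; apply: eq_bigr => k _.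
  by rewrite mu_cell ?ltn_subrL// /g subSS subKn// -ltnS.
Unshelve. all: by end_near. Qed.

End HoldingIntegral.

(** * Square-integrable controls *)

Section L2.
Variables (R : realType) (V : normedModType R).
Local Notation mu := (@lebesgue_measure R).
Implicit Types (u : R -> V) (T : R).

Lemma measurable_norm_sqr D u : strongly_measurable D u ->
  measurable_fun D (fun s => (`|u s| ^+ 2)%:E).
Proof.
move=> mu_; apply/measurable_EFinP.
apply: (@measurable_strongly_measurable _ _ D u (fun v => `|v| ^+ 2)) => // v.
rewrite /continuous_at expr2; under eq_fun do rewrite expr2.
by apply: cvgM; exact: norm_continuous.
Qed.

Lemma L2_sub_cst T u (v : V) : L2 T u -> L2 T (fun s => u s - v).
Proof.
move=> [su uoo].
have sv : strongly_measurable `]0, T[ (fun s => u s - v).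
  apply: strongly_measurable_sub => //; apply: strongly_measurable_simple.
  exact: simple_function_cst.
split=> //.
apply: (@le_lt_trans _ _ (\int[mu]_(s in `]0%R, T[)
    (2%:E * (`|u s| ^+ 2)%:E + (2 * `|v| ^+ 2)%:E))%E).
  apply: ge0_le_integral => //.
  - exact: measurable_norm_sqr.
  - apply: emeasurable_funD; last exact: measurable_cst.
    by apply: measurable_funeM; exact: measurable_norm_sqr.
  - move=> s _; rewrite -EFinM -EFinD lee_fin.
    have := ler_normB (u s) v; have := normr_ge0 (u s - v).
    move: `|_ - v| `|u s| `|v| => a b c a0 abc.
    have : a ^+ 2 <= (b + c) ^+ 2 by rewrite ler_sqr ?nnegrE ?(le_trans a0).
    by have := sqr_ge0 (b - c); nra.
rewrite ge0_integralD//=; last first.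
  by apply: measurable_funeM; exact: measurable_norm_sqr.
rewrite ge0_integralZl//; last exact: measurable_norm_sqr.
rewrite integral_cst//= lte_add_pinfty//.
  by rewrite lte_mul_pinfty// ?lee_fin.
rewrite lte_mul_pinfty ?lee_fin ?mulr_ge0 ?exprn_ge0//.
by rewrite lebesgue_measure_itv/=; case: ifP => _; rewrite ltry.
Qed.

Lemma L2_patch t T u (v : V) : 0 < t -> t < T -> L2 t u ->
  L2 T (patch (fun=> v) `]0, t[ u).
Proof.
move=> t0 tT [su uoo].
have sp : strongly_measurable `]0, T[ (patch (fun=> v) `]0, t[ u).
  apply: (@strongly_measurable_patch _ _ _ _ setT) => //.
    by move=> s _; right.
  by apply: strongly_measurable_simple; exact: simple_function_cst.
split=> //.
apply: (@le_lt_trans _ _ (\int[mu]_(s in `]0%R, t[) (`|u s| ^+ 2)%:E +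
   \int[mu]_(s in `[t, T[) (`|v| ^+ 2)%:E)%E).
  have TE : [set` `]0, T[] = [set` `]0, t[] `|` [set` `[t, T[].
    by apply: itv_bndbnd_setU; rewrite bnd_simp// ltW.
  rewrite [in leLHS]TE ge0_integral_setU//=.
  - rewrite le_eqVlt; apply/orP; left; apply/eqP; congr (_ + _)%E.
      by apply: eq_integral => s Ds; rewrite patchT.
    apply: eq_integral => s; rewrite inE/= in_itv/= => /andP[ts _].
    by rewrite patchN//; apply/negP; rewrite inE/= in_itv/= [s < t]ltNge ts andbF.
  - by rewrite -TE; exact: measurable_norm_sqr.
  - rewrite disj_set2E; apply/eqP; rewrite -subset0 => s [].
    by rewrite /= !in_itv/= => /andP[_ st] /andP[]; rewrite leNgt st.
rewrite lte_add_pinfty// integral_cst//=.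
rewrite lte_mul_pinfty ?lee_fin ?exprn_ge0//.
by rewrite lebesgue_measure_itv/=; case: ifP => _; rewrite ltry.
Qed.

(** [L2norm] goes through a real-valued integral, which is 0 when the extended one is infinite;
    membership in [L2] excludes this case. *)
Lemma le_L2norm T (u v : R -> V) : L2 T u -> L2 T v ->
  (forall s, `]0, T[%classic s -> `|u s| <= `|v s|) -> L2norm T u <= L2norm T v.
Proof.
move=> [su uoo] [sv voo] uv; rewrite /L2norm ler_sqrt; last first.
  by apply: Rintegral_ge0 => s _; rewrite exprn_ge0.
have int (w : R -> V) : strongly_measurable `]0, T[ w ->
    (\int[mu]_(s in `]0%R, T[) ((`|w s| ^+ 2)%:E) < +oo)%E ->
    mu.-integrable `]0, T[ (EFin \o (fun s => `|w s| ^+ 2)).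
  move=> sw woo; apply/integrableP; split.
    exact: measurable_norm_sqr.
  under eq_integral do rewrite /= ger0_norm ?exprn_ge0//.
  by [].
apply: le_Rintegral => //; [exact: int|exact: int|].
by move=> s Ds; rewrite ler_sqr ?nnegrE// uv.
Qed.

Lemma L2_subset t T u : t <= T -> L2 T u -> L2 t u.
Proof.
move=> tT [su uoo].
have sub : `]0, t[%classic `<=` `]0, T[%classic by apply: subset_itvl; rewrite bnd_simp.
split; first exact: subset_strongly_measurable su.
apply: le_lt_trans uoo; apply: ge0_subset_integral => //.
exact: measurable_norm_sqr.
Qed.

End L2.

Lemma within_continuous_dist (R : realType) (V : normedModType R) (D : set R)
    (f : R -> V) : {within D, continuous f} <->
  forall x e, D x -> 0 < e -> exists2 d, 0 < d &
    forall s, D s -> `|x - s| < d -> `|f x - f s| < e.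
Proof.
rewrite subspace_continuousP; split=> [cf x e Dx e0|cf x Dx].
  have /cvgrPdist_lt/(_ _ e0) := cf x Dx.
  by move=> [d /= d0 fd]; exists d => // s Ds xs; exact: fd.
apply/cvgrPdist_lt => e e0; have [d d0 fd] := cf x e Dx e0.
by exists d => //= s xs Ds; exact: fd.
Qed.

(** * Integrals against the singular weight 1 / (s - a) *)

Section Weight.
Variables (R : realType) (a b : R) (phi : R -> R).
Hypothesis phi0 : forall s, 0 <= phi s.
Hypothesis mphi : measurable_fun `]a, b[ phi.
Local Notation mu := (@lebesgue_measure R).
Local Notation g := (fun s => ((s - a)^-1 * phi s)%:E).

Lemma measurable_weight : measurable_fun `]a, b[ g.
Proof.
apply/measurable_EFinP; apply: measurable_funM => //.
apply: open_continuous_measurable_fun; first exact: interval_open.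
move=> s; rewrite inE/= in_itv/= => /andP[sa _].
apply: cvgV; first by rewrite subr_eq0 gt_eqF.
by apply: cvgB; [exact: cvg_id|exact: cvg_cst].
Qed.

Lemma weight_ge0 s : `]a, b[%classic s -> (0 <= g s)%E.
Proof.
rewrite /= in_itv/= => /andP[sa _].
by rewrite lee_fin mulr_ge0// invr_ge0 subr_ge0 ltW.
Qed.

(** The weight is at least 1 / (r - a) on ]l, r[. The interval [i] is general because halving
    produces intervals closed on the left. *)
Lemma weight_integral_ge (i : interval R) l r c : a < l -> l < r -> r <= b -> 0 < c ->
  [set` `]l, r[] `<=` [set` i] -> [set` i] `<=` `]a, b[ ->
  (forall s, l < s < r -> c <= phi s) ->
  ((c * (r - l) / (r - a))%:E <= \int[mu]_(s in [set` i]) g s)%E.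
Proof.
move=> al lr rb c0 lri iab cphi.
apply: (@le_trans _ _ (\int[mu]_(s in `]l, r[) g s)%E); last first.
  apply: ge0_subset_integral => //.
  - by apply: measurable_funS iab measurable_weight.
  - by move=> s /iab; exact: weight_ge0.
apply: (@le_trans _ _ (\int[mu]_(s in `]l, r[) cst (c / (r - a))%:E s)%E).
  rewrite integral_cst//= lebesgue_measure_itv/= lte_fin lr -EFinB -EFinM lee_fin.
  by rewrite mulrAC.
have ra : 0 < r - a by lra.
apply: ge0_le_integral => //.
- by move=> s _; rewrite lee_fin divr_ge0// ltW.
- apply: measurable_funS measurable_weight => //.
  exact: subset_trans lri iab.
- move=> s; rewrite /= in_itv/= => ls; rewrite lee_fin mulrC.
  have sa : 0 < s - a by lra.
  apply: ler_pM; rewrite ?invr_ge0 ?(ltW ra) ?(ltW c0) ?cphi//.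
  by rewrite lef_pV2 ?posrE//; lra.
Qed.

Lemma weight_integral_gt0 l r c : a <= l -> l < r -> r <= b -> 0 < c ->
  (forall s, l < s < r -> c <= phi s) -> (0 < \int[mu]_(s in `]a, b[) g s)%E.
Proof.
(* [weight_integral_ge] wants a left end strictly beyond a, and l may equal a. *)
move=> al lr rb c0 cphi; set m := (l + r) / 2.
have [lm mr] : l < m /\ m < r by rewrite /m; split; lra.
apply: (@lt_le_trans _ _ (c * (r - m) / (r - a))%:E).
  by rewrite lte_fin divr_gt0 ?mulr_gt0 ?subr_gt0//; lra.
apply: weight_integral_ge => //; first by lra.
  by move=> s; rewrite /= !in_itv/= => ms; lra.
by move=> s ms; apply: cphi; lra.
Qed.

(** The right half of ]a, r'[ contributes at least c / 2 whatever r' is, the measure ds / (s - a)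
    being invariant under scaling about a; n halvings give n c / 2. *)
Lemma weight_integral_pinfty r c : a < r -> r <= b -> 0 < c ->
  (forall s, a < s < r -> c <= phi s) -> (\int[mu]_(s in `]a, b[) g s = +oo)%E.
Proof.
move=> ar rb c0 cphi.
have half n : forall r', a < r' -> r' <= r ->
    ((n%:R * (c / 2))%:E <= \int[mu]_(s in `]a, r'[) g s)%E.
  elim: n => [|n IH] r' ar' r'r.
    rewrite mul0r; apply: integral_ge0 => s /=; rewrite in_itv/= => /andP[sa sr'].
    by apply: weight_ge0; rewrite /= in_itv/= sa; lra.
  set m := (a + r') / 2.
  have [am mr'] : a < m /\ m < r' by rewrite /m; split; lra.
  have mE : [set` `]a, r'[] = [set` `]a, m[] `|` [set` `[m, r'[].
    by apply: itv_bndbnd_setU; rewrite bnd_simp// ltW.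
  have sub : `]a, r'[%classic `<=` `]a, b[%classic.
    by apply: subset_itvl; rewrite bnd_simp; lra.
  rewrite mE in sub.
  rewrite [X in (_ <= \int[_]_(_ in X) _)%E]mE ge0_integral_setU//; last 3 first.
  - exact: measurable_funS sub measurable_weight.
  - by move=> s /sub; exact: weight_ge0.
  - rewrite disj_set2E; apply/eqP; rewrite -subset0 => s [].
    by rewrite /= !in_itv/= => /andP[_ sm] /andP[]; rewrite leNgt sm.
  rewrite -natr1 mulrDl mul1r EFinD leeD//; first by apply: IH; lra.
  rewrite (_ : c / 2 = c * (r' - m) / (r' - a)); last first.
    by rewrite /m; field; rewrite subr_eq0 gt_eqF.
  apply: weight_integral_ge => //; first by lra.
  - by apply: subset_itvr; rewrite bnd_simp.
  - by move=> s; rewrite /= !in_itv/= => /andP[ms sr']; lra.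
  - by move=> s ms; apply: cphi; lra.
apply/eqyP => K K0.
have [n nK] : exists n : nat, K <= n%:R * (c / 2).
  exists (Num.truncn (K / (c / 2))).+1.
  by rewrite -ler_pdivrMr ?divr_gt0// ltW// truncnS_gt.
apply: (@le_trans _ _ (n%:R * (c / 2))%:E); first by rewrite lee_fin.
apply: (le_trans (half n r ar (lexx _))); apply: ge0_subset_integral => //.
- exact: measurable_weight.
- by move=> s; exact: weight_ge0.
- by apply: subset_itvl; rewrite bnd_simp.
Qed.

End Weight.

(** * Mild solutions continued by a holding control *)

Section HoldExtension.
Variables (R : realType) (X U Xm : completeNormedModType R).
Variables (DA : set X) (A : X -> X) (S : R -> {linear X -> X}).
Hypothesis genA : neg_generates DA A S.
Variable j : {linear X -> Xm}.
Hypothesis exXm : extrapolation_space DA A j.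
Variable Am : {linear X -> Xm}.
Hypothesis exA : extrapolated_operator DA A j Am.
Variable Sm : R -> {linear Xm -> Xm}.
Hypothesis exS : extrapolated_semigroup S j Sm.
Variable B : {linear U -> Xm}.

Lemma mild_solution_subset t T x0 (u : R -> U) x : t <= T ->
  mild_solution S j Sm B T x0 u x -> mild_solution S j Sm B t x0 u x.
Proof.
move=> tT [cx ux]; split.
  by apply: continuous_subspaceW cx; apply: subset_itvl; rewrite bnd_simp.
by move=> s /andP[s0 st]; apply: ux; rewrite s0 (le_trans st).
Qed.

Lemma mild_solution_hold t0 T x0 xd ud (u : R -> U) x :
  0 < t0 -> t0 < T -> holdable Am B xd ud ->
  mild_solution S j Sm B t0 x0 u x -> x t0 = xd ->
  mild_solution S j Sm B T x0 (patch (fun=> ud) `]0, t0[ u)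
    (fun s => x (Num.min s t0)).
Proof.
move=> t00 t0T xdud [cx ux] xt0; split.
  apply/within_continuous_dist => s e; rewrite /= in_itv/= => /andP[s0 sT] e0.
  have min_in r : 0 <= r -> `[0, t0]%classic (Num.min r t0).
    by move=> r0; rewrite /= in_itv/= le_min r0 (ltW t00) ge_min lexx orbT.
  have [d d0 xsd] := (within_continuous_dist _ _).1 cx _ _ (min_in s s0) e0.
  exists d => // r; rewrite /= in_itv/= => /andP[r0 rT] sr.
  apply: xsd; first exact: min_in.
  (* Freezing time at t0 is 1-Lipschitz, so the same [d] works. *)
  apply: le_lt_trans sr; rewrite /Num.min.
  by case: ltP => st; case: ltP => rt; rewrite ?subrr ?normr0//;
    rewrite ler_norml; apply/andP; split;
    have := ler_norm (s - r); have := ler_norm (r - s); rewrite distrC; lra.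
move=> t /andP[t1 tT]; have [tt0|t0t] := leP t t0.
  apply: eq_is_bochner_integral (ux t _); last by rewrite t1.
  move=> s; rewrite inE/= in_itv/= => /andP[s0 st].
  by rewrite patchT// inE/= in_itv/= s0 (lt_le_trans st).
rewrite xt0 /input_to_state.
have tt0 : 0 <= t - t0 by rewrite subr_ge0 ltW.
have [cSm Smj] := exS tt0; have [[_ _ SD _] _] := genA.
(* The contributions of S (t - t0) xd to the two pieces cancel. *)
have -> : j (xd - S t x0) = Sm (t - t0) (j (x t0 - S t0 x0)) +
    j (xd - S (t - t0) xd).
  rewrite Smj xt0 -[RHS]linearD [S _ (_ - _)]linearB/= -SD ?(ltW t00)// subrK.
  by rewrite [X in _ = j X]addrC addrA subrK.
rewrite (_ : [set` `]0, t[] = [set` `]0, t0[] `|` [set` `[t0, t[]);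
  last by apply: itv_bndbnd_setU; rewrite bnd_simp// ltW.
apply: is_bochner_integral_setU => //.
- by rewrite lebesgue_measure_itv/=; case: ifP => _; rewrite ltry.
- by rewrite lebesgue_measure_itv/=; case: ifP => _; rewrite ltry.
- rewrite disj_set2E; apply/eqP; rewrite -subset0 => s [].
  by rewrite /= !in_itv/= => /andP[_ st] /andP[]; rewrite leNgt st.
(* Since t - s = (t - t0) + (t0 - s), the operator Sm (t - t0) comes out of the integral up to
   t0. *)
- apply: (@eq_is_bochner_integral _ _ _ (Sm (t - t0) \o
      (fun s => Sm (t0 - s) (B (u s))))).
    move=> s; rewrite inE => s0t; rewrite patchT ?inE//=.
    move: s0t; rewrite /= in_itv/= => /andP[s0 st].
    rewrite -(extrapolated_semigroupD genA exXm exS) ?subr_ge0 ?(ltW st) ?(ltW t0t)//.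
    by rewrite addrA subrK.
  apply: (is_bochner_integral_linear cSm) => //.
    by rewrite lebesgue_measure_itv/=; case: ifP => _; rewrite ltry.
  by apply: ux; rewrite lexx ltW.
- apply: (@eq_is_bochner_integral _ _ _ (fun s => Sm (t - s) (Am xd))).
    move=> s; rewrite inE/= in_itv/= => /andP[ts _].
    rewrite xdud patchN//; apply/negP.
    by rewrite inE/= in_itv/= [s < t0]ltNge ts andbF.
  exact: (is_bochner_integral_semigroup genA exXm exA exS).
Qed.

End HoldExtension.

(** * The optimality argument *)

Theorem theorem4 (R : realType) (X U Xm : completeNormedModType R)
  (hX : hilbert_space X) (hU : hilbert_space U)
  (DA : set X) (A : X -> X) (S : R -> {linear X -> X})
  (hS : neg_generates DA A S)
  (j : {linear X -> Xm}) (hXm : extrapolation_space DA A j)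
  (Am : {linear X -> Xm}) (hAm : extrapolated_operator DA A j Am)
  (Sm : R -> {linear Xm -> Xm}) (hSm : extrapolated_semigroup S j Sm)
  (B : {linear U -> Xm}) (hB : admissible_control_operator j Sm B)
  (x0 : X) (t0 T : R) (ht0 : 0 < t0) (hT : t0 < T)
  (hctrl : exactly_controllable S j Sm B t0)
  (xd : X) (ud : U) (hd : holdable Am B xd ud)
  (gamma : R) (hgamma : 0 < gamma)
  (uT : R -> U) (xT : R -> X)
  (hopt : optimal S j Sm B T t0 gamma x0 xd ud uT xT) :
  forall t : R, t0 <= t <= T -> xT t = xd.
Proof.
have [L2u mildu opt] := hopt.
pose hold u := patch (fun=> ud) `]0, t0[ u : R -> U.
pose tracking := (\int[lebesgue_measure]_(s in `]t0, T[)
  (((s - t0)^-1 * `|xT s - xd|)%:E))%E.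
have tracking_ge0 : (0 <= tracking)%E.
  apply: integral_ge0 => s; rewrite /= in_itv/= => /andP[sa _].
  by rewrite lee_fin mulr_ge0// invr_ge0 subr_ge0 ltW.
(* The right-hand side is a real number: the state of the competitor is xd on ]t0, T[, so it has no
   tracking cost. *)
have opt_hold u x : L2 t0 u -> mild_solution S j Sm B t0 x0 u x -> x t0 = xd ->
    ((2^-1 * L2norm T (fun s => uT s - ud)%R ^+ 2)%:E + gamma%:E * tracking <=
     (2^-1 * L2norm T (fun s => hold u s - ud)%R ^+ 2)%:E)%E.
  move=> L2u' mildx xt0.
  have := opt _ _ (L2_patch ud ht0 hT L2u')
    (mild_solution_hold hS hXm hAm hSm ht0 hT hd mildx xt0).
  rewrite /objective (_ : (\int[lebesgue_measure]_(s in `]t0, T[)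
      ((s - t0)^-1 * `|x (Num.min s t0) - xd|)%:E = 0)%E).
    by rewrite mule0 adde0.
  apply: integral0_eq => s; rewrite /= in_itv/= => /andP[t0s _].
  by rewrite min_r ?(ltW t0s)// xt0 subrr normr0 mulr0.
have [cxT _] := mildu.
(* A deviation from xd keeps at least half its size nearby; this half becomes the constant c of the
   weight estimates. *)
have dist_cont s : t0 <= s <= T -> xT s != xd -> exists2 d, 0 < d &
    forall r, t0 <= r <= T -> `|s - r| < d -> `|xT s - xd| / 2 <= `|xT r - xd|.
  move=> /andP[t0s sT] xs.
  have e0 : 0 < `|xT s - xd| / 2 by rewrite divr_gt0// normr_gt0 subr_eq0.
  have s0T : `[0, T]%classic s by rewrite /= in_itv/= sT (le_trans (ltW ht0)).
  have [d d0 xd_] := (within_continuous_dist _ _).1 cxT _ _ s0T e0.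
  exists d => // r /andP[t0r rT] sr.
  have := xd_ r; rewrite /= in_itv/= rT (le_trans (ltW ht0))// => /(_ isT sr).
  have := ler_distD (xT r) (xT s) xd; lra.
have mphi : measurable_fun `]t0, T[ (fun s => `|xT s - xd|).
  apply: open_continuous_measurable_fun; first exact: interval_open.
  move=> s; rewrite inE/= in_itv/= => /andP[t0s sT].
  have /(within_continuous_continuous (lt_trans ht0 hT)) := cxT.
  move=> /(_ s); rewrite in_itv/= sT (lt_trans ht0 t0s) => /(_ isT) cs.
  by apply: cvg_norm; apply: cvgB; [exact: cs|exact: cvg_cst].
have phi0 s : 0 <= `|xT s - xd| by [].
have xTt0 : xT t0 = xd.
  have [C1 _ ctrl] := hctrl; have [u [x [L2u' mildx xt0 _]]] := ctrl x0 xd.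
  apply/eqP/negPn/negP => xt0d.
  have [|d d0 xTd] := dist_cont t0 _ xt0d; first by rewrite lexx ltW.
  have tracking_oo : tracking = +oo%E.
    apply: (@weight_integral_pinfty _ t0 T _ phi0 mphi
        (Num.min T (t0 + d)) (`|xT t0 - xd| / 2)).
    - by rewrite lt_min hT ltrDl.
    - by rewrite ge_min lexx.
    - by rewrite divr_gt0// normr_gt0 subr_eq0.
    - move=> s; rewrite lt_min => /andP[t0s /andP[sT sd]].
      by apply: xTd; [lra|rewrite distrC gtr0_norm; lra].
  have := opt_hold u x L2u' mildx xt0.
  by rewrite tracking_oo gt0_muley ?lte_fin// addey.
have := opt_hold uT xT (L2_subset (ltW hT) L2u)
  (mild_solution_subset (ltW hT) mildu) xTt0.
have hold_le : L2norm T (fun s => hold uT s - ud) <= L2norm T (fun s => uT s - ud).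
  apply: le_L2norm.
  - apply: L2_sub_cst; apply: L2_patch => //; exact: L2_subset (ltW hT) L2u.
  - exact: L2_sub_cst.
  - by move=> s _; rewrite /hold /patch; case: ifP => // _; rewrite subrr normr0.
have cost_le : ((2^-1 * L2norm T (fun s => hold uT s - ud)%R ^+ 2)%:E <=
    (2^-1 * L2norm T (fun s => uT s - ud)%R ^+ 2)%:E)%E.
  by rewrite lee_fin ler_pM2l ?invr_gt0// ler_sqr ?nnegrE// sqrtr_ge0.
(* The control cost is real, so it can be subtracted, leaving gamma times the tracking integral at
   most 0. *)
move=> /le_trans/(_ cost_le); rewrite -leeBrDl// subee// => tracking_le0.
move=> t /andP[t0t tT]; apply/eqP/negPn/negP => xtd.
have t0t' : t0 < t.
  by rewrite lt_neqAle t0t andbT; apply: contra xtd => /eqP <-; rewrite xTt0.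
have [|d d0 xTd] := dist_cont t _ xtd; first by rewrite t0t.
(* The interval ends at t, so that t = T is allowed; the maximum keeps it beyond t0. *)
have : (0 < tracking)%E.
  apply: (@weight_integral_gt0 _ t0 T _ phi0 mphi
      (Num.max t0 (t - d)) t (`|xT t - xd| / 2)) => //.
  - by rewrite le_max lexx.
  - by rewrite gt_max t0t' ltrBlDr ltrDl.
  - by rewrite divr_gt0// normr_gt0 subr_eq0.
  - move=> s; rewrite gt_max => /andP[/andP[t0s ds] st].
    by apply: xTd; [lra|rewrite gtr0_norm; lra].
rewrite ltNge => /negP; apply.
by move: tracking_le0; rewrite pmule_rle0// lte_fin.
Qed.
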